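(* Let $(W,S)$ be a finite Coxeter system. The map $\varphi$ defined below is a dimension-preserving bijection from the set of faces of the order complex of the BHZ poset $(W,\leq_\beta)$ (i.e. nonempty strict chains) to the set of faces of $\Delta(W)$; that is, it maps strict chains with $k$ elements bijectively onto the faces of $\Delta(W)$ with $k$ vertices, for every $k\geq 1$. Definition of $\varphi$: for a strict chain $e=u_1<_\beta u_2<_\beta\dots<_\beta u_k$ containing $e$, set $\varphi(u_1<_\beta\dots<_\beta u_k)=\{w_j\mid 1\leq j\leq k\}$ with $w_j=u_ku_j^{-1}$ (equivalently $w_j=(u_k)^{S(u_j)}$). For a strict chain $u_1<_\beta\dots<_\beta u_k$ not containing $e$, set $\varphi(u_1<_\beta\dots<_\beta u_k)=\varphi(e<_\beta u_1<_\beta\dots<_\beta u_k)\setminus\{e\}$.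
   Context: $e$ is the identity and $\ell$ the length function. $D_R(w)=\{s\in S\mid \ell(ws)<\ell(w)\}$; $S(w)$ is the set of $s\in S$ appearing in some (equivalently any) reduced word for $w$. For $I\subseteq S$, $W_I$ is the standard parabolic subgroup generated by $I$, $w_{\circ,I}$ its longest element, $W^I=\{w\in W\mid D_R(w)\cap I=\emptyset\}$, and every $w$ factors uniquely as $w=w^Iw_I$ with $w^I\in W^I$, $w_I\in W_I$. BHZ order: $u\leq_\beta v$ iff $v_{S(u)}=u$. Right weak order: $u\leq_R v$ iff $\ell(u^{-1}v)=\ell(v)-\ell(u)$. The $W$-permutahedron $\mathrm{Perm}(W)$ is the convex hull of the orbit $W\cdot x$ of a generic point $x$ in the space on which $W$ acts as a finite reflection group; its vertices are identified with $W$ via $w\mapsto w(x)$. Its faces are indexed by cosets $wW_I$ ($I\subseteq S$): the face $F_{wW_I}$ has dimension $\#I$ and vertex set $wW_I=[w^I,w^Iw_{\circ,I}]_R$, so each face has a unique minimal vertex $w^I$ for $\leq_R$. For a polytope $Q$ in which every face has a unique minimal vertex for a given order, the pulling triangulation of $Q$ is defined recursively: let $v$ be the minimal vertex of $Q$; take the pulling triangulations (with the restricted order) of all facets of $Q$ not containing $v$, and cone each of their simplices over $v$. $\Delta(W)$ is the pulling triangulation of $\mathrm{Perm}(W)$ with respect to the right weak order; its faces are identified with their vertex sets, which are subsets of $W$. *)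

(* Defs.v *)
From HB Require Import structures.
From mathcomp Require Import all_boot all_order all_algebra all_fingroup.
From mathcomp Require Import mxrepresentation.
From mathcomp Require Import mathcomp_extra boolp classical_sets functions.
From mathcomp Require Import reals convex.

Set Implicit Arguments.
Unset Strict Implicit.
Unset Printing Implicit Defensive.

Import Order.TTheory GRing.Theory Num.Theory.

Section Coxeter.

Local Open Scope group_scope.

Variables (gT : finGroupType) (S : {set gT}).

(* The whole type [gT] is the group W. The last clause is the universal
   property of the presentation <S | (st)^m(s,t) = 1>: as W is finite, every
   m(s,t) is finite and equal to the order #[s * t]. The case s = t covers the
   relations s^2 = 1. *)
Definition coxeter_system : Prop :=
  [/\ <<S>> = [set: gT],
      {in S, forall s, #[s] = 2%N} &
      forall (H : groupType) (f : gT -> H),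
        {in S &, forall s t, (f s * f t) ^+ #[s * t] = 1} ->
        exists2 g : gT -> H, {morph g : u v / u * v} & {in S, g =1 f}].

Definition word_of (w : gT) (ws : seq gT) : bool :=
  all (mem S) ws && (\prod_(s <- ws) s == w).

(* When S generates W, a shortest word has pairwise distinct partial products,
   hence fewer than #|W| letters; searching the lengths up to #|W| suffices. *)
Definition len (w : gT) : nat :=
  find (fun k => [exists t : k.-tuple gT, word_of w t]) (iota 0 #|gT|.+1).

Definition gen_support (w : gT) : {set gT} :=
  [set s | [exists t : (len w).-tuple gT, word_of w t && (s \in t)]].

Definition right_descents (w : gT) : {set gT} :=
  [set s in S | len (w * s) < len w].

Definition min_reps (I : {set gT}) : {set gT} :=
  [set w | [disjoint right_descents w & I]].

(* The factors w^I and w_I of w = w^I w_I, with w^I in W^I and w_I in W_I. *)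
Definition min_part (I : {set gT}) (w : gT) : gT :=
  odflt 1 [pick u in min_reps I | u^-1 * w \in <<I>>].

Definition para_part (I : {set gT}) (w : gT) : gT := (min_part I w)^-1 * w.

Definition bhz_le (u v : gT) : bool := para_part (gen_support u) v == u.

Definition bhz_lt (u v : gT) : bool := (u != v) && bhz_le u v.

(* l(u^-1 v) = l(v) - l(u), written without truncated subtraction. *)
Definition weak_le (u v : gT) : bool := len u + len (u^-1 * v) == len v.

Definition bhz_chain (us : seq gT) : Prop := us != [::] /\ sorted bhz_lt us.

Definition phi_with1 (us : seq gT) : {set gT} :=
  [set last 1 us * u^-1 | u in us].

Definition phi (us : seq gT) : {set gT} :=
  if 1 \in us then phi_with1 us else phi_with1 (1 :: us) :\ 1.

Lemma phi_min_part u v : bhz_le u v -> v * u^-1 = min_part (gen_support u) v.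
Proof. by move/eqP=> {1}<-; rewrite /para_part invMg invgK mulKVg. Qed.

End Coxeter.

Local Open Scope classical_set_scope.
Local Open Scope ring_scope.

Section Polytopes.

Variables (R : realType) (n : nat).
Implicit Types (A Q F sigma tau : set 'cV[R]_n) (u v y z : 'cV[R]_n).
Implicit Type le : 'cV[R]_n -> 'cV[R]_n -> Prop.

Definition dot y z : R := (y^T *m z) 0 0.

Definition convex_hull A : set 'cV[R]_n :=
  smallest (@convex_set R 'cV[R]_n) A.

(* For a polytope Q all nonempty faces are exposed by a linear functional (Q
   itself by c = 0); the empty set also counts as a face, so that it is the
   unique facet of a point. *)
Definition face Q F : Prop :=
  F = set0 \/
  exists c, F = [set y | Q y /\ forall z, Q z -> dot c z <= dot c y].

Definition facet Q F : Prop :=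
  [/\ face Q F, F <> Q &
      forall G, face Q G -> F `<=` G -> G = F \/ G = Q].

Definition vertex Q v : Prop := face Q [set v].

Definition minimal_vertex le Q v : Prop :=
  vertex Q v /\ forall u, vertex Q u -> le u v -> u = v.

(* Vertex sets of the maximal simplices of the pulling triangulation of Q. The
   empty polytope has the empty simplex as its triangulation, so that coning
   over a point v (whose only facet is empty) yields the simplex {v}. *)
Inductive pulling_simplex le : set 'cV[R]_n -> set 'cV[R]_n -> Prop :=
| Pulling_empty : pulling_simplex le set0 set0
| Pulling_cone Q F v sigma :
    minimal_vertex le Q v -> facet Q F -> ~ F v ->
    pulling_simplex le F sigma -> pulling_simplex le Q (v |` sigma).

Definition pulling_face le Q tau : Prop :=
  tau !=set0 /\ exists2 sigma, pulling_simplex le Q sigma & tau `<=` sigma.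

End Polytopes.

Section Permutahedron.

Variables (R : realType) (gT : finGroupType) (S : {set gT}) (n : nat).
Variable rho : mx_representation R [set: gT]%G n.

(* W acts on column vectors on the left, w(y) = rho w *m y. *)
Implicit Types (alpha : gT -> 'cV[R]_n) (x y : 'cV[R]_n).

(* W acts faithfully on Euclidean space R^n as a finite reflection group, the
   elements of S being the reflections in the roots of the simple system
   (alpha s)_(s in S): these roots are linearly independent, and every root
   w(alpha s) is a combination of them with coefficients of constant sign.
   The roots may have arbitrary lengths. *)
Definition reflection_action alpha : Prop :=
  [/\ mx_faithful rho,
      forall s y, s \in S ->
        rho s *m y =
          y - (2 * dot (alpha s) y / dot (alpha s) (alpha s)) *: alpha s,
      forall c : gT -> R,
        \sum_(s in S) c s *: alpha s = 0 -> {in S, forall s, c s = 0} &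
      forall w s, s \in S -> exists c : gT -> R,
        rho w *m alpha s = \sum_(t in S) c t *: alpha t /\
        ({in S, forall t, 0 <= c t} \/ {in S, forall t, c t <= 0})].

(* The generic point lies in the open chamber bounded by the mirrors of the
   elements of S. In another chamber y(C) the faces of the permutahedron would
   correspond to the sets w W_I y^-1 rather than to the cosets w W_I. *)
Definition in_chamber alpha x : Prop :=
  {in S, forall s, 0 < dot (alpha s) x}.

Definition perm_polytope x : set 'cV[R]_n :=
  convex_hull [set rho w *m x | w in [set: gT]].

Definition weak_le_pt x (p q : 'cV[R]_n) : Prop :=
  exists u v, [/\ weak_le S u v, p = rho u *m x & q = rho v *m x].

(* Faces of Delta(W), as subsets of W through w |-> w(x). *)
Definition delta_face x (F : {set gT}) : Prop :=
  pulling_face (weak_le_pt x) (perm_polytope x)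
    [set rho w *m x | w in [set` F]].

End Permutahedron.

(* Main.v *)
(* Every face vW_I of the permutahedron has the minimal vertex v^I, so a maximal
   simplex of the pulling triangulation is the set of the v^I, where vW_I runs
   through a maximal flag of faces in which each face avoids the minimal vertex
   of the previous one; the first vertex is e. A face with vertex e thus has the
   form {v^I_1, ..., v^I_k} with v one of its vertices and the I_j nested. Each
   I_j may be shrunk to the support of u_j = v_I_j without changing v^I_j, and
   then the u_j form a chain for the BHZ order, with u_k = v and
   v^I_j = v u_j^-1. As e lies in every maximal simplex and below every element
   of the BHZ order, chains and faces without e are obtained by deleting e.
   The positivity of the roots gives descents and coset representatives (the
   root of s is made negative by w iff s is a descent of w), and maximizing a
   linear functional over the orbit shows that the faces of the permutahedron
   are the hulls of cosets. *)
Require Import Defs.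
From mathcomp Require Import all_boot all_order all_algebra all_fingroup.
From mathcomp Require Import mxrepresentation.
From mathcomp Require Import boolp classical_sets functions reals.
From mathcomp Require Import convex interval_inference.
From mathcomp Require Import zify ring lra.

Set Implicit Arguments.
Unset Strict Implicit.
Unset Printing Implicit Defensive.

Import Order.TTheory GRing.Theory Num.Theory.

(** * Words and lengths *)

Section Words.

Local Open Scope group_scope.

Variables (gT : finGroupType) (S : {set gT}).
Hypothesis genS : <<S>> = [set: gT].

Implicit Types (I J : {set gT}) (u v w s t : gT) (ws : seq gT).

Lemma word_ofP w ws :
  reflect (all (mem S) ws /\ \prod_(s <- ws) s = w) (word_of S w ws).
Proof. by apply: (iffP andP) => -[? /eqP]. Qed.

Lemma gen_word I w :
  w \in <<I>> -> exists2 ws, all (mem I) ws & \prod_(s <- ws) s = w.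
Proof.
move=> /gen_prodgP[k [c cI ->]]; exists [seq c i | i <- enum 'I_k].
  by apply/allP => _ /mapP[i _ ->]; apply: cI.
by rewrite big_map enumT.
Qed.

Lemma word_gen I ws : all (mem I) ws -> \prod_(s <- ws) s \in <<I>>.
Proof.
elim: ws => [|s ws IH] /=; first by rewrite big_nil group1.
case/andP=> sI /IH wsI; rewrite big_cons groupM //; exact: mem_gen.
Qed.

(* The partial products of a shortest word are distinct, by cutting out the
   letters between two equal ones. *)
Lemma short_word w ws :
  word_of S w ws -> exists2 ws', word_of S w ws' & (size ws' <= #|gT|)%N.
Proof.
have [m] := ubnP (size ws); elim: m ws => // m IH ws sz wP.
have [szws|ltws] := leqP (size ws) #|gT|; first by exists ws.
have [wS wE] := word_ofP _ _ wP.
pose f (i : 'I_(size ws).+1) := \prod_(s <- take i ws) s.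
have /injectivePn[i [j neq_ij fij]] : ~~ injectiveb f.
  apply/injectiveP => /leq_card; rewrite card_ord => le.
  by have := leq_trans ltws (ltnW le); rewrite ltnn.
wlog ltij : i j neq_ij fij / (i < j)%N.
  move=> H; have [/H|/H|/val_inj eij] := ltngtP i j; first exact.
    by apply=> //; rewrite eq_sym.
  by rewrite eij eqxx in neq_ij.
apply: (IH (take i ws ++ drop j ws)).
  rewrite size_cat size_take size_drop; move: (ltn_ord j) (ltn_ord i).
  by case: ifP; lia.
apply/word_ofP; split.
  have: all (mem S) (take i ws ++ drop i ws) by rewrite cat_take_drop.
  have: all (mem S) (take j ws ++ drop j ws) by rewrite cat_take_drop.
  by rewrite !all_cat => /andP[_ ->] /andP[->].
by rewrite -wE -[in RHS](cat_take_drop j ws) !big_cat /= [X in X * _]fij.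
Qed.

(** Generation provides a word, and [short_word] brings one into the range searched by [len], so the
    search succeeds. *)
Lemma len_word w : exists2 ws, word_of S w ws & size ws = len S w.
Proof.
pose p k := [exists t : k.-tuple gT, word_of S w t].
have hasp : has p (iota 0 #|gT|.+1).
  have /gen_word[ws0 ws0S ws0E] : w \in <<S>> by rewrite genS inE.
  have [|ws wP sz] := @short_word w ws0; first by apply/word_ofP.
  apply/hasP; exists (size ws); first by rewrite mem_iota.
  by apply/existsP; exists (in_tuple ws).
have := nth_find 0%N hasp; rewrite has_find size_iota in hasp.
rewrite nth_iota // => /existsP[t tP]; exists t => //.
by rewrite size_tuple.
Qed.

Lemma len_le w ws : word_of S w ws -> (len S w <= size ws)%N.
Proof.
move=> wP; have [//|lt] := leqP (len S w) (size ws).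
have lenN : (len S w <= #|gT|.+1)%N.
  by rewrite /len -[leqRHS](size_iota 0) find_size.
have := before_find 0%N lt; rewrite nth_iota ?(leq_trans lt) //.
by move=> /existsP[]; exists (in_tuple ws).
Qed.

Lemma len1 : len S 1 = 0%N.
Proof.
apply/eqP; rewrite -leqn0; apply: (@len_le 1 [::]).
by rewrite /word_of big_nil eqxx.
Qed.

Lemma len_eq0 w : len S w = 0%N -> w = 1.
Proof.
have [ws /word_ofP[_ <-] <-] := len_word w.
by move/size0nil->; rewrite big_nil.
Qed.

Lemma len_mul_gen w s : s \in S -> (len S (w * s) <= (len S w).+1)%N.
Proof.
move=> sS; have [ws /word_ofP[wS <-] <-] := len_word w.
rewrite -(size_rcons ws s); apply: len_le.
apply/word_ofP; rewrite all_rcons wS andbT -cats1 big_cat big_seq1; split=> //.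
Qed.

Lemma gen_supportP w s :
  reflect (exists2 ws, word_of S w ws /\ size ws = len S w & s \in ws)
          (s \in gen_support S w).
Proof.
rewrite inE; apply: (iffP existsP) => [[t /andP[tP st]]|[ws [wP /eqP sz] sws]].
  by exists t => //; rewrite size_tuple.
by exists (Tuple sz); rewrite wP.
Qed.

Lemma gen_support_sub w : gen_support S w \subset S.
Proof.
by apply/fintype.subsetP => s /gen_supportP[ws [/word_ofP[/allP wS _] _] /wS].
Qed.

Lemma gen_support_gen w : w \in <<gen_support S w>>.
Proof.
have [ws wP sz] := len_word w; have [_ <-] := word_ofP _ _ wP.
rewrite word_gen //; apply/allP => s sws /=.
by have [_ ->] := word_ofP _ _ wP; apply/gen_supportP; exists ws.
Qed.

End Words.

(** * Dot product and convex hulls *)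

Section Dot.

Local Open Scope ring_scope.

Variables (R : realType) (n : nat).
Implicit Types (y z : 'cV[R]_n).

Lemma dotE y z : dot y z = \sum_i y i 0 * z i 0.
Proof. by rewrite /dot mxE; apply: eq_bigr => i _; rewrite mxE. Qed.

Lemma dotC y z : dot y z = dot z y.
Proof. by rewrite !dotE; apply: eq_bigr => i _; rewrite mulrC. Qed.

Lemma dotDr y z z' : dot y (z + z') = dot y z + dot y z'.
Proof. by rewrite /dot mulmxDr mxE. Qed.

Lemma dotZr y k z : dot y (k *: z) = k * dot y z.
Proof. by rewrite /dot -scalemxAr mxE. Qed.

Lemma dotNr y z : dot y (- z) = - dot y z.
Proof. by rewrite -scaleN1r dotZr mulN1r. Qed.

Lemma dotBr y z z' : dot y (z - z') = dot y z - dot y z'.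
Proof. by rewrite dotDr dotNr. Qed.

Lemma dot0r y : dot y 0 = 0.
Proof. by rewrite -(scale0r 0) dotZr mul0r. Qed.

Lemma dot_sumr y (I : finType) (P : pred I) (F : I -> 'cV[R]_n) :
  dot y (\sum_(i | P i) F i) = \sum_(i | P i) dot y (F i).
Proof. by apply: (big_morph (dot y)); [exact: dotDr | exact: dot0r]. Qed.

Lemma dotZl k y z : dot (k *: y) z = k * dot y z.
Proof. by rewrite !(dotC _ z) dotZr. Qed.

Lemma dotNl y z : dot (- y) z = - dot y z.
Proof. by rewrite !(dotC _ z) dotNr. Qed.

Lemma dotBl y y' z : dot (y - y') z = dot y z - dot y' z.
Proof. by rewrite !(dotC _ z) dotBr. Qed.

Lemma dot_suml (I : finType) (P : pred I) (F : I -> 'cV[R]_n) z :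
  dot (\sum_(i | P i) F i) z = \sum_(i | P i) dot (F i) z.
Proof. by rewrite dotC dot_sumr; apply: eq_bigr => i _; rewrite dotC. Qed.

Lemma dot_gt0 y : y != 0 -> 0 < dot y y.
Proof.
move=> y0; rewrite lt_neqAle dotE sumr_ge0 => [|i _]; last exact: sqr_ge0.
rewrite andbT eq_sym; apply: contra y0 => /eqP.
move/psumr_eq0P => H; apply/eqP/colP => i; rewrite mxE.
by apply/eqP; rewrite -sqrf_eq0 expr2 H // => j _; exact: sqr_ge0.
Qed.

Lemma mulmx_cV_inj (A B : 'M[R]_n) : (forall y, A *m y = B *m y) -> A = B.
Proof.
move=> AB; apply/matrixP => i j.
by have := AB (delta_mx j 0); rewrite -!colE => /colP/(_ i); rewrite !mxE.
Qed.

End Dot.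

Section ConvexHull.

Local Open Scope classical_set_scope.
Local Open Scope ring_scope.

Variables (R : realType) (n : nat).
Implicit Types (A K V : set 'cV[R]_n) (c y z : 'cV[R]_n) (M : R).

Lemma dot_conv c y z (l : {i01 R}) :
  dot c (conv l (y : convex_lmodType 'cV[R]_n) z) =
  l%:num * dot c y + (1 - l%:num) * dot c z.
Proof. by rewrite /conv /= dotDr !dotZr. Qed.

Lemma convex_setP K :
  (forall y z (l : {i01 R}), 0 < l%:num -> l%:num < 1 -> K y -> K z ->
     K (conv l (y : convex_lmodType 'cV[R]_n) z)) ->
  @convex_set R 'cV[R]_n K.
Proof.
move=> H; apply/convex_setW => y z Ky Kz l l0 l1.
by apply/mem_set/H => //; apply: set_mem.
Qed.

Lemma convex_hullS A : A `<=` convex_hull A.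
Proof. exact: sub_smallest. Qed.

Lemma convex_hull_min A K :
  @convex_set R 'cV[R]_n K -> A `<=` K -> convex_hull A `<=` K.
Proof. exact: smallest_sub. Qed.

Lemma convex_hull_convex A : @convex_set R 'cV[R]_n (convex_hull A).
Proof.
move=> y z l /set_mem hy /set_mem hz; apply/mem_set => K [cK AK].
by apply/set_mem/cK; apply/mem_set; [apply: hy | apply: hz].
Qed.

Lemma convex_hull_le A c M : (forall y, A y -> dot c y <= M) ->
  forall y, convex_hull A y -> dot c y <= M.
Proof.
move=> H y; apply: (convex_hull_min (K := [set y | dot c y <= M])) => //.
apply: convex_setP => {}y z l l0 l1 /= yM zM; rewrite dot_conv; nra.
Qed.

Lemma convex_hull_lt A c M : (forall y, A y -> dot c y < M) ->
  forall y, convex_hull A y -> dot c y < M.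
Proof.
move=> H y; apply: (convex_hull_min (K := [set y | dot c y < M])) => //.
apply: convex_setP => {}y z l l0 l1 /= yM zM; rewrite dot_conv; nra.
Qed.

Lemma convex_hull_eq A c M : (forall y, A y -> dot c y = M) ->
  forall y, convex_hull A y -> dot c y = M.
Proof.
move=> H y hy; apply/eqP; rewrite eq_le (convex_hull_le _ hy) => [|z /H->//].
rewrite -lerN2 -dotNl; apply: convex_hull_le hy => z /H<-.
by rewrite dotNl.
Qed.

Lemma convex_hull1 y : convex_hull [set y] = [set y].
Proof.
apply/seteqP; split; last exact: convex_hullS.
apply: convex_hull_min => //; apply: convex_setP => z t l _ _ -> ->.
exact: (@convmm R (convex_lmodType 'cV[R]_n)).
Qed.

(* The points of the hull that are either below the level [M] or in the hull
   of the vertices of level [M] form a convex set. *)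
Lemma exposed_convex_hull V c M y0 : V y0 -> dot c y0 = M ->
  (forall y, V y -> dot c y <= M) ->
  [set y | convex_hull V y /\ forall z, convex_hull V z -> dot c z <= dot c y] =
  convex_hull [set y | V y /\ dot c y = M].
Proof.
move=> Vy0 y0M VM; set V0 := [set y | V y /\ _].
have V0M y : convex_hull V0 y -> dot c y = M by apply: convex_hull_eq => z [].
apply/seteqP; split=> y /=.
  move=> [hy ymax].
  have yM : dot c y = M.
    apply/eqP; rewrite eq_le (convex_hull_le VM hy) /= -y0M.
    by apply: ymax; apply: convex_hullS.
  suff: [set y | dot c y < M \/ convex_hull V0 y] y.
    by case=> //=; rewrite yM ltxx.
  apply: convex_hull_min hy => [|z Vz] /=; last first.
    have := VM z Vz; rewrite le_eqVlt => /orP[/eqP zM|]; last by left.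
    by right; apply: convex_hullS.
  apply: convex_setP => z t l l0 l1 /= [zM|hz] [tM|ht].
  - by left; rewrite dot_conv; nra.
  - by left; rewrite dot_conv (V0M t) //; nra.
  - by left; rewrite dot_conv (V0M z) //; nra.
  - by right; apply/set_mem/convex_hull_convex; apply/mem_set.
move=> hy; split.
  apply: convex_hull_min hy; first exact: convex_hull_convex.
  by move=> z [Vz _]; apply: convex_hullS.
by move=> z hz; rewrite (V0M y hy); apply: convex_hull_le hz.
Qed.

End ConvexHull.

(** * Roots and parabolic cosets *)

Section Roots.

Local Open Scope ring_scope.

Variables (R : realType) (gT : finGroupType) (S : {set gT}) (n : nat).
Variable rho : mx_representation R [set: gT]%G n.
Variables (alpha : gT -> 'cV[R]_n) (x : 'cV[R]_n).
Hypothesis genS : <<S>>%g = [set: gT].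
Hypothesis ordS : {in S, forall s, #[s]%g = 2%N}.
Hypothesis reflS : reflection_action S rho alpha.
Hypothesis genx : in_chamber S alpha x.

Implicit Types (I J : {set gT}) (u v w s t : gT) (y z : 'cV[R]_n).

Let len := len S.

Lemma gen_sqr s : s \in S -> (s * s = 1)%g.
Proof. by move=> sS; rewrite -expg2 -(ordS sS) expg_order. Qed.

Lemma gen_mulK w s : s \in S -> (w * s * s = w)%g.
Proof. by move=> sS; rewrite -mulgA gen_sqr // mulg1. Qed.

Lemma rhoM u v y : rho (u * v)%g *m y = rho u *m (rho v *m y).
Proof. by rewrite repr_mxM ?inE // mulmxA. Qed.

Lemma rho1 y : rho 1%g *m y = y.
Proof. by rewrite repr_mx1 mul1mx. Qed.

Lemma rhoK u y : rho u^-1%g *m (rho u *m y) = y.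
Proof. by rewrite -rhoM mulVg rho1. Qed.

Lemma rhoVK u y : rho u *m (rho u^-1%g *m y) = y.
Proof. by rewrite -rhoM mulgV rho1. Qed.

(** The pairing of [y] with the coroot of [alpha s]. *)
Definition mirror_coef s y : R :=
  2 * dot (alpha s) y / dot (alpha s) (alpha s).

Lemma rho_gen s y : s \in S -> rho s *m y = y - mirror_coef s y *: alpha s.
Proof. by case: reflS => _ H _ _; exact: H. Qed.

Definition comb (c : gT -> R) : 'cV[R]_n := \sum_(t in S) c t *: alpha t.

Lemma combB c d : comb c - comb d = comb (fun t => c t - d t).
Proof. by rewrite -sumrB; apply: eq_bigr => t _; rewrite scalerBl. Qed.

Lemma combD c d : comb c + comb d = comb (fun t => c t + d t).
Proof. by rewrite -big_split; apply: eq_bigr => t _; rewrite scalerDl. Qed.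

Lemma combZ k c : k *: comb c = comb (fun t => k * c t).
Proof. by rewrite scaler_sumr; apply: eq_bigr => t _; rewrite scalerA. Qed.

Lemma comb_inj c d : comb c = comb d -> {in S, c =1 d}.
Proof.
move=> /eqP; rewrite -subr_eq0 combB => /eqP cd t tS.
by case: reflS => _ _ /(_ _ cd t tS)/eqP + _; rewrite subr_eq0 => /eqP.
Qed.

Lemma comb_gen s : s \in S -> alpha s = comb (fun t => (t == s)%:R).
Proof.
move=> sS; rewrite /comb (bigD1 s) //= eqxx scale1r big1 ?addr0 //.
by move=> t /andP[_ /negPf->]; rewrite scale0r.
Qed.

Lemma alpha_neq0 s : s \in S -> alpha s != 0.
Proof.
move=> sS; apply/eqP => a0.
have: comb (fun t => (t == s)%:R) = comb (fun=> 0).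
  by rewrite -comb_gen // a0 /comb big1 // => t _; rewrite scale0r.
by move/comb_inj/(_ s sS)/eqP; rewrite eqxx oner_eq0.
Qed.

Lemma dot_alpha_gt0 s : s \in S -> 0 < dot (alpha s) (alpha s).
Proof. by move=> sS; rewrite dot_gt0 ?alpha_neq0. Qed.

Lemma mirror_coef_gt0 s : s \in S -> 0 < mirror_coef s x.
Proof.
by move=> sS; rewrite divr_gt0 ?dot_alpha_gt0 // mulr_gt0 ?ltr0n ?genx.
Qed.

Lemma rho_gen_alpha s : s \in S -> rho s *m alpha s = - alpha s.
Proof.
move=> sS; rewrite rho_gen // /mirror_coef mulfK ?gt_eqF ?dot_alpha_gt0 //.
by rewrite scaler_nat mulr2n opprD addrA subrr add0r.
Qed.

Lemma gen_ind (P : gT -> Prop) :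
  P 1%g -> (forall s w, s \in S -> P w -> P (s * w)%g) -> forall w, P w.
Proof.
move=> P1 PM w; have /gen_word[ws wsS <-] : w \in <<S>>%g by rewrite genS inE.
elim: ws wsS => [|s ws IH] /=; first by rewrite big_nil.
by case/andP=> sS /IH Pw; rewrite big_cons; apply: PM.
Qed.

(** Reflections are isometries, whatever the lengths of the roots, and they generate the group. *)
Lemma dot_rho w y z : dot (rho w *m y) (rho w *m z) = dot y z.
Proof.
elim/gen_ind: w => [|s w sS IH]; first by rewrite !rho1.
rewrite !rhoM -IH !(rho_gen _ sS) dotBl !dotBr !dotZl !dotZr /mirror_coef.
rewrite (dotC _ (alpha s)).
have := dot_alpha_gt0 sS; move/lt0r_neq0 => a0; field.
exact: a0.
Qed.

Lemma dot_rhoV w y z : dot (rho w *m y) z = dot y (rho w^-1%g *m z).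
Proof. by rewrite -(dot_rho w y) rhoVK. Qed.

(** * Positive and negative roots *)

(** Pairing with the generic point turns the sign alternative of [reflection_action] into a boolean
    test. *)
Definition pos w s : bool := 0 < dot (rho w *m alpha s) x.

Definition in_cone I y := exists c, [/\ y = comb c,
  {in S, forall t, 0 <= c t} & {in S, forall t, t \notin I -> c t = 0}].

Definition in_span I y := exists2 c, y = comb c &
  {in S, forall t, t \notin I -> c t = 0}.

Lemma dot_comb c z : dot (comb c) z = \sum_(t in S) c t * dot (alpha t) z.
Proof. by rewrite dot_suml; apply: eq_bigr => t _; rewrite dotZl. Qed.

Lemma root_cone w s :
  s \in S -> in_cone S (rho w *m alpha s) \/ in_cone S (- (rho w *m alpha s)).
Proof.
move=> sS; case: reflS => _ _ _ /(_ w s sS)[c [-> [c0|c0]]]; [left|right].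
  by exists c; split=> // t ->.
exists (fun t => -1 * c t); split=> [|t tS|t ->] //.
  by rewrite -combZ scaleN1r.
by rewrite mulN1r oppr_ge0 c0.
Qed.

Lemma in_cone_dot_ge0 y : in_cone S y -> 0 <= dot y x.
Proof.
move=> [c [-> c0 _]]; rewrite dot_comb sumr_ge0 // => t tS.
by rewrite mulr_ge0 ?c0 // ltW // genx.
Qed.

Lemma in_cone_dot_eq0 y : in_cone S y -> dot y x = 0 -> y = 0.
Proof.
move=> [c [-> c0 _]]; rewrite dot_comb => /psumr_eq0P H.
rewrite /comb big1 // => t tS.
have /eqP : c t * dot (alpha t) x = 0.
  by apply: H => // r rS; rewrite mulr_ge0 ?c0 // ltW // genx.
by rewrite mulf_eq0 (gt_eqF (genx tS)) orbF => /eqP->; rewrite scale0r.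
Qed.

Lemma root_neq0 w s : s \in S -> rho w *m alpha s != 0.
Proof.
move=> sS; apply: contra (alpha_neq0 sS) => /eqP E.
by rewrite -(rhoK w (alpha s)) E mulmx0.
Qed.

(** Up to sign the root is a nonzero nonnegative combination of simple roots, each of which pairs
    strictly positively with [x]. *)
Lemma dot_root_neq0 w s : s \in S -> dot (rho w *m alpha s) x != 0.
Proof.
move=> sS; apply: contra (root_neq0 w sS) => /eqP E.
case: (root_cone w sS) => [/in_cone_dot_eq0->//|/in_cone_dot_eq0].
by rewrite -oppr_eq0 dotNl E oppr0 => ->.
Qed.

Lemma pos_cone w s : s \in S -> pos w s -> in_cone S (rho w *m alpha s).
Proof.
move=> sS; rewrite /pos => p; case: (root_cone w sS) => // /in_cone_dot_ge0.
by rewrite dotNl oppr_ge0 leNgt p.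
Qed.

Lemma posN w s : s \in S -> ~~ pos w s = (dot (rho w *m alpha s) x < 0).
Proof. by move=> sS; rewrite /pos -leNgt lt_neqAle dot_root_neq0. Qed.

Lemma neg_cone w s : s \in S -> ~~ pos w s -> in_cone S (- (rho w *m alpha s)).
Proof.
move=> sS; rewrite posN // => p.
case: (root_cone w sS) => // /in_cone_dot_ge0.
by rewrite leNgt p.
Qed.

Lemma pos1 s : s \in S -> pos 1%g s.
Proof. by move=> sS; rewrite /pos rho1 genx. Qed.

Lemma pos_mul_gen w s : s \in S -> pos (w * s)%g s = ~~ pos w s.
Proof.
move=> sS; rewrite posN // /pos rhoM rho_gen_alpha // mulmxN dotNl.
by rewrite oppr_gt0.
Qed.

(* A simple reflection changes only one simple coordinate, so the only
   positive roots that it makes negative are the multiples of its root. *)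
Lemma pos_to_neg t w s : t \in S -> s \in S -> pos w s -> ~~ pos (t * w)%g s ->
  exists2 k, k != 0 & rho w *m alpha s = k *: alpha t.
Proof.
move=> tS sS /(pos_cone sS)[c [wE c0 _]] /(neg_cone sS)[d [twE d0 _]].
have wE' : rho w *m alpha s = c t *: alpha t.
  rewrite wE /comb (bigD1 t) //= big1 ?addr0 // => r /andP[rS rt].
  suff -> : c r = 0 by rewrite scale0r.
  have E : comb (fun r => c r - mirror_coef t (comb c) * (r == t)%:R)
         = comb (fun r => -1 * d r).
    rewrite -combZ -twE scaleN1r opprK rhoM rho_gen // wE.
    by rewrite -combB -combZ -comb_gen.
  have := comb_inj E rS; rewrite /= (negPf rt) mulr0 subr0 mulN1r => cr.
  by apply/eqP; rewrite eq_le c0 // cr oppr_le0 d0.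
exists (c t) => //; apply: contraNneq (root_neq0 w sS) => ct0.
by rewrite wE' ct0 scale0r.
Qed.

(** Conjugation by [w] turns the reflection in [alpha s] into that in a multiple of [alpha t]; the
    factor [k] cancels, and faithfulness carries the identity to the group. *)
Lemma conj_gen t w s k : t \in S -> s \in S -> k != 0 ->
  rho w *m alpha s = k *: alpha t -> (t * w = w * s)%g.
Proof.
move=> tS sS k0 wE; case: reflS => faith _ _ _.
apply: (mx_faithful_inj faith); rewrite ?inE //.
apply: mulmx_cV_inj => y; rewrite !rhoM (rho_gen _ tS).
rewrite (rho_gen _ sS) mulmxBr -scalemxAr wE.
rewrite scalerA; congr (_ - _ *: _).
have E1 : dot (alpha s) (alpha s) = k ^+ 2 * dot (alpha t) (alpha t).
  by rewrite -(dot_rho w) wE dotZl dotZr; ring.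
have E2 : dot (alpha s) y = k * dot (alpha t) (rho w *m y).
  by rewrite -(dot_rho w) wE dotZl.
rewrite /mirror_coef E1 E2.
have := dot_alpha_gt0 tS; move/lt0r_neq0 => a0; field.
by rewrite k0 a0.
Qed.

(** Reading the word from its right end, the root of [s] starts positive and ends negative; deleting
    the letter that flips its sign multiplies the product by [s]. *)
Lemma exchange ws s : all (mem S) ws -> s \in S ->
  ~~ pos (\prod_(t <- ws) t)%g s ->
  exists ws', [/\ all (mem S) ws', (size ws' < size ws)%N &
    (\prod_(t <- ws') t = \prod_(t <- ws) t * s)%g].
Proof.
move=> + sS; elim: ws => [|t ws IH] /=; first by rewrite big_nil pos1.
case/andP=> tS wsS; rewrite big_cons => neg.
have [p|/(IH wsS)[ws' [ws'S lt E]]] := boolP (pos (\prod_(t <- ws) t)%g s).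
  (* Here [t] flips the sign: [t * w = w * s] for the product [w] of [ws], so [ws] itself is the
     shorter word. *)
  exists ws; split=> //.
  have [k k0 E] := pos_to_neg tS sS p neg.
  by rewrite -mulgA -(conj_gen tS sS k0 E) mulgA gen_sqr // mul1g.
exists (t :: ws'); split=> //=; first by rewrite tS.
by rewrite big_cons E mulgA.
Qed.

(** * Lengths, descents and parabolic factorizations *)

Lemma len_neg w s : s \in S -> ~~ pos w s -> (len (w * s)%g < len w)%N.
Proof.
move=> sS; have [ws /word_ofP[wsS <-] sz] := len_word genS w.
case/(exchange wsS sS) => ws' [ws'S lt E]; rewrite [leqRHS]/len -sz.
by apply: leq_ltn_trans lt; apply: len_le => //; apply/word_ofP.
Qed.

Lemma len_pos w s : s \in S -> pos w s -> len (w * s)%g = (len w).+1.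
Proof.
move=> sS p; apply/eqP; rewrite eqn_leq len_mul_gen //=.
have: ~~ pos (w * s)%g s by rewrite pos_mul_gen // negbK.
by move/(len_neg sS); rewrite gen_mulK.
Qed.

Lemma min_repsP I w : I \subset S ->
  reflect {in I, forall s, pos w s} (w \in min_reps S I).
Proof.
move=> /fintype.subsetP IS; rewrite inE disjoint_sym disjoint_subset.
apply: (iffP fintype.subsetP) => H s sI.
  have := H s sI; rewrite !inE (IS _ sI) /=; apply: contraR => /len_neg.
  by apply; apply: IS.
by rewrite !inE (IS _ sI) /= -/(len _) -/(len w) len_pos ?IS ?H // ltnNge ltnW.
Qed.

(** Each reflection in [I] changes a vector by a multiple of a root of [I] only. *)
Lemma rho_span I w y : I \subset S -> w \in <<I>>%g ->
  in_span I (rho w *m y - y).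
Proof.
move=> /fintype.subsetP IS /gen_word[ws wsI <-].
elim: ws wsI => [|s ws IH] /=.
  rewrite big_nil rho1 subrr; exists (fun=> 0) => //.
  by rewrite /comb big1 // => t _; rewrite scale0r.
case/andP=> sI /IH[c wE c0]; rewrite big_cons rhoM rho_gen ?IS //.
set k := mirror_coef _ _; set z := _ *m y in wE *.
exists (fun t => c t - k * (t == s)%:R) => [|t tS tI].
  by rewrite -combB -combZ -comb_gen ?IS // -wE addrAC.
rewrite c0 // (_ : t == s = false) ?mulr0 ?subr0 //.
by apply: contraNF tI => /eqP->.
Qed.

(** If [s] were outside [I], the coefficient of [alpha s] in its image under [w] would remain 1 by
    [rho_span], which no negative root allows. *)
Lemma neg_mem I w s : I \subset S -> w \in <<I>>%g -> s \in S -> ~~ pos w s ->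
  s \in I.
Proof.
move=> IS wI sS /(neg_cone sS)[d [wE d0 _]]; apply: contraT => sI.
have [c E c0] := rho_span (alpha s) IS wI.
have: comb (fun t => -1 * d t) = comb (fun t => c t + (t == s)%:R).
  by rewrite -combZ -wE -combD -comb_gen // -E subrK scaleN1r opprK.
move/comb_inj/(_ s sS); rewrite c0 // eqxx add0r mulN1r => ds.
by have := d0 s sS; rewrite -oppr_le0 ds ler10.
Qed.

Lemma neg_exists w : w != 1%g -> exists2 s, s \in S & ~~ pos w s.
Proof.
have [ws] := len_word genS w; case/lastP: ws => [|ws s] /word_ofP[].
  by rewrite big_nil => _ <-; rewrite eqxx.
rewrite all_rcons -cats1 big_cat big_seq1 /= => /andP[sS wsS] E sz _.
exists s => //; apply: contraPN sz => p; rewrite size_cat addn1.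
suff: (len w < (size ws).+1)%N by rewrite /len => /ltn_eqF/eqP/nesym.
rewrite -(len_pos sS p) -E gen_mulK //.
by apply: leq_trans (leqnSn _); apply: len_le => //; apply/word_ofP.
Qed.

(** A nontrivial element has a descent, which lies in [I] by [neg_mem]; removing it stays in the
    subgroup and lowers the length. *)
Lemma reduced_ind I (P : gT -> Prop) : I \subset S -> P 1%g ->
  (forall w s, w \in <<I>>%g -> s \in I -> pos w s -> P w -> P (w * s)%g) ->
  forall w, w \in <<I>>%g -> P w.
Proof.
move=> IS P1 PM w; have [m] := ubnP (len w); elim: m w => // m IH w lt wI.
have [->//|/neg_exists[s sS neg]] := eqVneq w 1%g.
have sI := neg_mem IS wI sS neg.
have wsI : (w * s)%g \in <<I>>%g by rewrite groupM // mem_gen.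
rewrite -(gen_mulK w sS); apply: PM => //; first by rewrite pos_mul_gen.
by apply: IH => //; apply: leq_trans (len_neg sS neg) _.
Qed.

(** By [neg_mem], applied to the last letter of a reduced word and then to the rest, every reduced
    word of an element of the parabolic subgroup has its letters in [I]. *)
Lemma gen_supportE I w :
  I \subset S -> (w \in <<I>>%g) = (gen_support S w \subset I).
Proof.
move=> IS; apply/idP/idP => [wI|sub]; last first.
  exact: (fintype.subsetP (fingroup.genS sub)) _ (gen_support_gen genS w).
apply/fintype.subsetP => s /gen_supportP[ws [/word_ofP[wsS E] sz]].
suff /allP H : all (mem I) ws by move/H.
elim/last_ind: ws w wI wsS E sz {s} => // ws s IH w wI.
rewrite !all_rcons size_rcons => /andP[sS wsS].
rewrite -cats1 big_cat big_seq1 /= => E sz.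
have wsE : (\prod_(t <- ws) t = w * s)%g by rewrite -E gen_mulK.
have le : (len (w * s)%g <= size ws)%N.
  by apply: len_le => //; apply/word_ofP.
have neg : ~~ pos w s.
  apply/negP => /(len_pos sS) F; move: le.
  by rewrite F /len -sz => /ltnW; rewrite ltnn.
have sI := neg_mem IS wI sS neg; apply/andP; split; first exact: sI.
apply: (IH (w * s)%g) => //; first by rewrite groupM // mem_gen.
apply/eqP; rewrite eqn_leq le andbT -ltnS sz -[in leqLHS](gen_mulK w sS).
exact: len_mul_gen.
Qed.

Lemma pos_cone_gen I w s : I \subset S -> w \in <<I>>%g -> s \in I ->
  pos w s -> in_cone I (rho w *m alpha s).
Proof.
move=> IS wI sI p; have sS := fintype.subsetP IS s sI.
have [c [wE c0 _]] := pos_cone sS p; have [d E d0] := rho_span (alpha s) IS wI.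
exists c; split=> // t tS tI.
have: comb c = comb (fun t => d t + (t == s)%:R).
  by rewrite -wE -combD -comb_gen // -E subrK.
move/comb_inj/(_ t tS)->; rewrite d0 // (_ : t == s = false) ?addr0 //.
by apply: contraNF tI => /eqP->.
Qed.

(** A positive image of [alpha s] under [v] is a nonnegative combination of roots of [I], all kept
    positive by [u]. The converse applies this to [v * s], where both signs are reversed. *)
Lemma pos_mul I u v s : I \subset S -> u \in min_reps S I -> v \in <<I>>%g ->
  s \in I -> pos (u * v)%g s = pos v s.
Proof.
move=> IS /(min_repsP _ IS) uI vI sI; have sS := fintype.subsetP IS s sI.
have H w : w \in <<I>>%g -> pos w s -> pos (u * w)%g s.
  move=> wI /(pos_cone_gen IS wI sI)[c [wE c0 cI]].
  rewrite /pos lt_neqAle eq_sym dot_root_neq0 //= rhoM wE /comb mulmx_sumr.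
  rewrite dot_suml sumr_ge0 // => t tS; rewrite -scalemxAr dotZl.
  have [tI|tI] := boolP (t \in I); last by rewrite cI // mul0r.
  by rewrite mulr_ge0 ?c0 // ltW //; exact: uI.
apply/idP/idP; last exact: H.
apply: contraLR; rewrite -!pos_mul_gen // -mulgA; apply: H.
by rewrite groupM // mem_gen.
Qed.

(** [v] is reached by ascents inside [I], and by [pos_mul] these stay ascents after multiplication
    by [u] on the left. *)
Lemma min_reps_len I u v : I \subset S -> u \in min_reps S I ->
  v \in <<I>>%g -> len (u * v)%g = (len u + len v)%N.
Proof.
move=> IS uI; move: v; apply: (reduced_ind IS) => [|w s wI sI p IH].
  by rewrite mulg1 [len 1%g]len1 // addn0.
have sS := fintype.subsetP IS s sI.
by rewrite mulgA (len_pos sS p) len_pos ?(pos_mul IS) // IH addnS.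
Qed.

(** Length additivity holds from [u] to [v] and from [v] to [u], so [u^-1 * v] has length 0. *)
Lemma min_reps_uniq I u v : I \subset S -> u \in min_reps S I ->
  v \in min_reps S I -> (u^-1 * v)%g \in <<I>>%g -> u = v.
Proof.
move=> IS uI vI uv; have := min_reps_len IS uI uv; rewrite mulKVg => E.
have: (v^-1 * u)%g \in <<I>>%g.
  by rewrite -[(v^-1 * u)%g]invgK invMg invgK groupV.
move/(min_reps_len IS vI); rewrite mulKVg => E'.
have /(len_eq0 genS) : Defs.len S (u^-1 * v)%g = 0%N.
  by rewrite /len in E E'; lia.
by move=> uv1; apply/eqP; rewrite eq_mulVg1 uv1.
Qed.

(** Removing descents in [I] as long as there are any ends in a minimal representative, so the
    [pick] in [min_part] never falls back on its default value. *)
Lemma min_part_spec I w : I \subset S ->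
  min_part S I w \in min_reps S I /\ ((min_part S I w)^-1 * w)%g \in <<I>>%g.
Proof.
move=> IS; rewrite /min_part; case: pickP => [u /andP[]//|H].
suff [u uI uw] : exists2 u, u \in min_reps S I & (u^-1 * w)%g \in <<I>>%g.
  by have := H u; rewrite uI uw.
have [m] := ubnP (len w); elim: m w {H} => // m IH w lt.
have [wI|] := boolP (w \in min_reps S I).
  by exists w => //; rewrite mulVg group1.
have [/existsP[s /andP[sI neg]] _|] :=
    boolP [exists s, (s \in I) && ~~ pos w s].
  have sS := fintype.subsetP IS s sI.
  have [|u uI uw] := IH (w * s)%g; first exact: leq_trans (len_neg sS neg) _.
  by exists u; rewrite // -(gen_mulK w sS) mulgA groupM // mem_gen.
rewrite negb_exists => /forallP H /negP[]; apply/(min_repsP _ IS) => s sI.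
by have := H s; rewrite sI negbK.
Qed.

Lemma min_part_eq I u w : I \subset S -> u \in min_reps S I ->
  (u^-1 * w)%g \in <<I>>%g -> min_part S I w = u.
Proof.
move=> IS uI uw; have [mI mw] := min_part_spec w IS.
apply: (min_reps_uniq IS) => //.
have -> : ((min_part S I w)^-1 * u = (min_part S I w)^-1 * w * (u^-1 * w)^-1)%g.
  by rewrite invMg invgK mulgA mulgK.
by rewrite groupM ?groupV.
Qed.

(** * The BHZ order and flag simplices *)

Lemma mem_gen_self I s : I \subset S -> s \in S -> s \in <<I>>%g -> s \in I.
Proof.
move=> IS sS sI; apply: (neg_mem IS sI sS).
by rewrite -{1}(mul1g s) pos_mul_gen // pos1.
Qed.

Lemma min_reps_subset I J w : J \subset S -> I \subset J ->
  w \in min_reps S J -> w \in min_reps S I.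
Proof.
move=> JS IJ /(min_repsP _ JS) wJ; apply/min_repsP.
  exact: fintype.subset_trans JS.
by move=> s /(fintype.subsetP IJ)/wJ.
Qed.

Lemma min_reps1 I : I \subset S -> 1%g \in min_reps S I.
Proof.
by move=> IS; apply/min_repsP => // s /(fintype.subsetP IS); apply: pos1.
Qed.

Implicit Types (us : seq gT).

Local Notation supp := (gen_support S).
Local Notation suppS := (gen_support_sub S).

(** Uniqueness of the parabolic factorization, applied to [v = (v * u^-1) * u]. *)
Lemma bhz_leP u v :
  reflect ((v * u^-1)%g \in min_reps S (supp u)) (bhz_le S u v).
Proof.
apply: (iffP idP) => [le|vu].
  by rewrite (phi_min_part le); case: (min_part_spec v (suppS u)).
rewrite /bhz_le /para_part (min_part_eq (suppS u) vu) invMg invgK mulgKV //.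
exact: gen_support_gen.
Qed.

Lemma bhz_len u v : bhz_le S u v -> len v = (len (v * u^-1)%g + len u)%N.
Proof.
move/bhz_leP => vu; rewrite -(min_reps_len (suppS u) vu) ?mulgKV //.
exact: gen_support_gen.
Qed.

Lemma bhz_support u v : bhz_le S u v -> supp u \subset supp v.
Proof.
move=> le; apply/fintype.subsetP => s.
case/gen_supportP=> ws [/word_ofP[wsS E] sz] sws.
have [ws' /word_ofP[ws'S E'] sz'] := len_word genS (v * u^-1)%g.
apply/gen_supportP; exists (ws' ++ ws); last by rewrite mem_cat sws orbT.
split; last by rewrite size_cat sz sz' -(bhz_len le).
by apply/word_ofP; rewrite all_cat ws'S big_cat /= E E' mulgKV.
Qed.

Lemma bhz_lt_len u v : bhz_lt S u v -> (len u < len v)%N.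
Proof.
case/andP=> uv /bhz_len ->; rewrite -[ltnLHS]add0n ltn_add2r lt0n.
apply: contra uv => /eqP/(len_eq0 genS) vu1.
by rewrite eq_sym eq_mulgV1 vu1.
Qed.

Lemma bhz_lt_irr : irreflexive (bhz_lt S).
Proof. by move=> u; rewrite /bhz_lt eqxx. Qed.

(** In [w * u^-1 = (w * v^-1) * (v * u^-1)] the left factor is minimal for the support of [v], and
    the right factor lies in the subgroup of that support; by [pos_mul] the left factor does not
    affect descents in the support of [u]. *)
Lemma bhz_lt_trans : transitive (bhz_lt S).
Proof.
move=> v u w uv vw; rewrite /bhz_lt; apply/andP; split.
  have := ltn_trans (bhz_lt_len uv) (bhz_lt_len vw).
  by apply: contraTneq => ->; rewrite ltnn.
case/andP: uv => _ uv; case/andP: vw => _ vw; apply/bhz_leP.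
have -> : (w * u^-1 = (w * v^-1) * (v * u^-1))%g by rewrite mulgA mulgKV.
have sub := bhz_support uv.
apply/(min_repsP _ (suppS u)) => s su; have sv := fintype.subsetP sub s su.
have vuv : (v * u^-1)%g \in <<supp v>>%g.
  rewrite groupM ?groupV ?gen_support_gen //.
  exact: (fintype.subsetP (fingroup.genS sub)) _ (gen_support_gen genS u).
rewrite (pos_mul (suppS v) (elimT (bhz_leP _ _) vw) vuv sv).
by move: s su {sv}; apply/(min_repsP _ (suppS u))/bhz_leP.
Qed.

Lemma bhz_lt1 u : u != 1%g -> bhz_lt S 1%g u.
Proof.
move=> u1; rewrite /bhz_lt eq_sym u1 /=.
have /eqP s1 : supp 1%g == finset.set0.
  by rewrite -finset.subset0 -(gen_supportE 1%g (finset.sub0set S)) group1.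
by apply/bhz_leP/(min_repsP _ (suppS 1%g)) => s; rewrite s1 inE.
Qed.

Lemma bhz_path1_notin us : path (bhz_lt S) 1%g us -> 1%g \notin us.
Proof.
move/(order_path_min bhz_lt_trans)/allP => H.
by apply/negP => /H; rewrite bhz_lt_irr.
Qed.

Lemma bhz_chain_cases us : bhz_chain S us ->
  (exists2 us', us = 1%g :: us' & path (bhz_lt S) 1%g us') \/
  [/\ us != [::], path (bhz_lt S) 1%g us & 1%g \notin us].
Proof.
case: us => [|u us] [//= _ p]; have [eu|u1] := eqVneq u 1%g.
  by left; exists us; rewrite -?eu.
have p1 : path (bhz_lt S) 1%g (u :: us) by rewrite /= bhz_lt1.
by right; split=> //; apply: bhz_path1_notin.
Qed.

(* [flag I c sigma]: the simplex of the pulling triangulation of the face wW_I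
   with minimal vertex [c] whose vertices are the minimal elements of the cosets
   in a maximal flag of faces, each of which avoids the minimal vertex of the
   previous one. *)
Inductive flag : {set gT} -> gT -> {set gT} -> Prop :=
| Flag_point c : flag finset.set0 c [set c]%SET
| Flag_cone I s c c' sigma :
    s \in I -> c' \in min_reps S (I :\ s) -> (c^-1 * c')%g \in <<I>>%g ->
    (c'^-1 * c)%g \notin <<I :\ s>>%g -> flag (I :\ s) c' sigma ->
    flag I c (c |: sigma).

Lemma flag_min I c sigma : flag I c sigma -> c \in sigma.
Proof. by case=> [c0|I0 s c0 c' sg *]; rewrite !inE ?eqxx. Qed.

(** For [s] in [I], the coset of [c * s] modulo [I :\ s] avoids [c], because [s] is not in the
    subgroup generated by [I :\ s]. *)
Lemma flag_exists I c : I \subset S -> exists sigma, flag I c sigma.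
Proof.
have [m] := ubnP #|I|; elim: m I c => // m IH I c lt IS.
have [->|/set0Pn[s sI]] := eqVneq I finset.set0.
  by exists [set c]; apply: Flag_point.
have JS : I :\ s \subset S by apply: fintype.subset_trans IS; apply: subD1set.
have sS := fintype.subsetP IS s sI.
have [cJ cs] := min_part_spec (c * s)%g JS; set c' := min_part _ _ _ in cJ cs.
have [|sigma fl] := IH (I :\ s) c' _ JS.
  by rewrite (cardsD1 s) sI in lt.
exists (c |: sigma); apply: (Flag_cone sI cJ _ _ fl).
  have -> : (c^-1 * c' = s * (c'^-1 * (c * s))^-1)%g.
    by rewrite !invMg invgK !mulgA mulgV mul1g.
  rewrite groupM ?groupV //; first exact: mem_gen.
  exact: (fintype.subsetP (fingroup.genS (subD1set I s))).
apply/negP => c'c; have : s \in <<I :\ s>>%g.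
  by rewrite -(groupMl _ c'c) -mulgA.
by move/(mem_gen_self JS sS); rewrite !inE eqxx.
Qed.

(* If [A] is the largest set of [Js] for which v^A <> c, then some facet
   vW_(I\s) with A inside I\s avoids [c], and it contains the remaining v^A. *)
Lemma flag_cover I c v (Js : seq {set gT}) : I \subset S ->
  c \in min_reps S I -> (c^-1 * v)%g \in <<I>>%g ->
  sorted (fun A B : {set gT} => B \subset A) Js ->
  all (fun A : {set gT} => A \subset I) Js ->
  exists2 sigma, flag I c sigma & {in Js, forall A, min_part S A v \in sigma}.
Proof.
(* The measure allows two moves: passing to a facet, which shrinks [I], or discarding a set whose
   minimal element is [c] itself. *)
have [m] := ubnP (#|I| + size Js); elim: m I c Js => // m IH I c Js lt IS cI cv.
case: Js lt => [|A Js] lt.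
  by move=> _ _; have [sigma fl] := flag_exists c IS; exists sigma.
move=> srt /= /andP[AI JsI]; have AS := fintype.subset_trans AI IS.
have [mA|mA] := eqVneq (min_part S A v) c.
  have [||sigma fl H] := IH I c Js _ IS cI cv _ JsI.
  - by move: lt; rewrite /= addnS.
  - exact: path_sorted srt.
  exists sigma => // B; rewrite inE => /orP[/eqP->|/H//].
  by rewrite mA (flag_min fl).
have cvA : (c^-1 * v)%g \notin <<A>>%g.
  apply: contraNN mA => cvA; apply/eqP; apply: min_part_eq => //.
  exact: min_reps_subset cI.
have: ~~ (supp (c^-1 * v)%g \subset A) by rewrite -gen_supportE.
case/subsetPn => s scv sA.
have sI : s \in I.
  by move: scv; apply/fintype.subsetP; rewrite -gen_supportE.
have JI : I :\ s \subset I by apply: subD1set.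
have JS : I :\ s \subset S by apply: fintype.subset_trans IS.
have cvJ : (c^-1 * v)%g \notin <<I :\ s>>%g.
  rewrite gen_supportE //; apply/negP => /fintype.subsetP/(_ s scv).
  by rewrite !inE eqxx.
have AJ : A \subset I :\ s by rewrite subsetD1 AI sA.
have [c'J c'v] := min_part_spec v JS; set c' := min_part _ _ _ in c'J c'v.
have [||sigma fl H] := IH (I :\ s) c' (A :: Js) _ JS c'J c'v srt.
- by move: lt; rewrite (cardsD1 s) sI.
- rewrite /= AJ; apply/allP => B BJs.
  have tr : transitive (fun A B : {set gT} => B \subset A).
    by move=> X Y Z YX XZ; apply: fintype.subset_trans YX.
  have /allP/(_ B BJs) := order_path_min tr srt.
  by move=> BA; apply: fintype.subset_trans AJ.
exists (c |: sigma); last by move=> B /H; rewrite !inE => ->; rewrite orbT.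
apply: (Flag_cone sI c'J _ _ fl).
  have -> : (c^-1 * c' = (c^-1 * v) * (c'^-1 * v)^-1)%g.
    by rewrite invMg invgK mulgA mulgK.
  rewrite groupM ?groupV //.
  exact: (fintype.subsetP (fingroup.genS JI)).
apply: contra cvJ => cc'.
have -> : (c^-1 * v = (c'^-1 * c)^-1 * (c'^-1 * v))%g.
  by rewrite invMg invgK mulgA mulgK.
by rewrite groupM ?groupV.
Qed.

(* With [y] the last vertex of [G] along the flag, each vertex [g] of [G] gives
   the element g^-1 * y of the chain; [c] is the first vertex. *)
Lemma flag_chain I c sigma : flag I c sigma -> I \subset S ->
  c \in min_reps S I ->
  forall G : {set gT}, G \subset sigma -> G != finset.set0 ->
  exists us (y : gT), [/\ path (bhz_lt S) 1%g us,
    G = [set (y * u^-1)%g | u in 1%g :: us],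
    last 1%g us \in <<I>>%g /\ (c^-1 * y)%g \in <<I>>%g,
    {in 1%g :: us, forall u, bhz_le S u y} &
    c \in G -> last 1%g us = (c^-1 * y)%g].
Proof.
have single (d : gT) : [set d] = [set (d * u^-1)%g | u in [:: 1%g]] :> {set gT}.
  apply/setP => g; rewrite inE; apply/eqP/imsetP => [->|[u]].
    by exists 1%g; rewrite ?mem_head // invg1 mulg1.
  by rewrite inE => /eqP-> ->; rewrite invg1 mulg1.
(* A single vertex [d] gives the chain reduced to the identity, with [y = d]. *)
have point (J : {set gT}) d : exists us (y : gT), [/\ path (bhz_lt S) 1%g us,
    [set d] = [set (y * u^-1)%g | u in 1%g :: us],
    last 1%g us \in <<J>>%g /\ (d^-1 * y)%g \in <<J>>%g,
    {in 1%g :: us, forall u, bhz_le S u y} &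
    d \in [set d] -> last 1%g us = (d^-1 * y)%g].
  exists [::], d; rewrite mulVg group1; split=> // u.
  rewrite inE => /eqP->; have [->|/bhz_lt1/andP[]//] := eqVneq d 1%g.
  by apply/bhz_leP; rewrite mulgV min_reps1 ?suppS.
elim=> [{}c IS cI G Gc Gn|
       {}I s {}c c' {}sigma sI c'J cc' c'c fl IH IS cI G Gs Gn].
  have -> : G = [set c].
    by apply/eqP; rewrite eqEcard Gc cards1 card_gt0.
  exact: point.
have JI : I :\ s \subset I by apply: subD1set.
have JS : I :\ s \subset S by apply: fintype.subset_trans IS.
have gJI := fintype.subsetP (fingroup.genS JI).
have /orP[cG|cG] := orbN (c \in G); last first.
  have [|us [y [p E [lJ yJ] le _]]] := IH JS c'J G _ Gn.
    apply/fintype.subsetP => g gG; have := fintype.subsetP Gs g gG.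
    by rewrite !inE; case: eqP => // eg; rewrite -eg gG in cG.
  exists us, y; split=> // [|cG']; last by rewrite cG' in cG.
  split; first exact: gJI.
  have -> : (c^-1 * y = (c^-1 * c') * (c'^-1 * y))%g by rewrite mulgA mulgK.
  by rewrite groupM ?(gJI _ yJ).
have [G0|Gn'] := eqVneq (G :\ c) finset.set0.
  have -> : G = [set c].
    by rewrite -(finset.setD1K cG) G0 finset.setU0.
  exact: point.
have [|us [y [p E [lJ yJ] le _]]] := IH JS c'J (G :\ c) _ Gn'.
  apply/fintype.subsetP => g; rewrite !inE => /andP[gc gG].
  by have := fintype.subsetP Gs g gG; rewrite !inE (negPf gc).
have cyI : (c^-1 * y)%g \in <<I>>%g.
  have -> : (c^-1 * y = (c^-1 * c') * (c'^-1 * y))%g by rewrite mulgA mulgK.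
  by rewrite groupM ?(gJI _ yJ).
set u := last 1%g us in lJ.
have uus : u \in 1%g :: us by apply: mem_last.
have yuG : (y * u^-1)%g \in G :\ c by rewrite E; apply/imsetP; exists u.
have supJ : supp u \subset I.
  by apply: fintype.subset_trans JI; rewrite -gen_supportE.
(* The chain grows by [c^-1 * y]. It differs from [u] since [c] is not in [G :\ c]; and as [c] is
   minimal for [I], cancelling it on the left changes no sign on the support of [u]. *)
have ltu : bhz_lt S u (c^-1 * y)%g.
  apply/andP; split.
    apply/negP => /eqP uE; move: yuG.
    by rewrite uE invMg invgK mulKVg !inE eqxx.
  apply/bhz_leP/(min_repsP _ (suppS u)) => t tu.
  have tI := fintype.subsetP supJ t tu.
  rewrite -(pos_mul IS cI) //; last by rewrite groupM ?groupV // gJI.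
  rewrite !mulgA mulgV mul1g.
  by move: t tu {tI}; apply/(min_repsP _ (suppS u))/bhz_leP/le.
exists (rcons us (c^-1 * y)%g), y; split.
- by rewrite rcons_path p.
- rewrite -(finset.setD1K cG) E; apply/setP => g; rewrite !inE.
  apply/orP/imsetP => [[/eqP->|/imsetP[w wus ->]]|[w + ->]].
  + exists (c^-1 * y)%g; last by rewrite invMg invgK mulKVg.
    by rewrite inE mem_rcons inE eqxx orbT.
  + exists w => //; move: wus.
    by rewrite !inE mem_rcons inE orbCA => ->; rewrite orbT.
  rewrite !inE mem_rcons inE orbCA => /orP[/eqP->|wus].
    by left; rewrite invMg invgK mulKVg.
  by right; apply/imsetP; exists w; rewrite // inE.
- by rewrite last_rcons.
- move=> w; rewrite inE mem_rcons inE orbCA => /orP[/eqP->|wus]; last first.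
    by apply: le; rewrite inE.
  apply/bhz_leP; rewrite invMg invgK mulKVg.
  by apply: min_reps_subset cI; rewrite // -gen_supportE.
- by rewrite last_rcons.
Qed.

(** * The map [phi] between chains and flag simplices *)

Definition flag_face (F : {set gT}) : Prop :=
  F != finset.set0 /\ exists2 sigma, flag S 1%g sigma & F \subset sigma.

Local Notation phi1 us := (phi_with1 (1%g :: us)).

Lemma bhz_path_last us u : path (bhz_lt S) 1%g us -> u \in 1%g :: us ->
  bhz_le S u (last 1%g us).
Proof.
move=> p; rewrite inE => /orP[/eqP->|].
  have [->|/bhz_lt1/andP[]//] := eqVneq (last 1%g us) 1%g.
  by apply/bhz_leP; rewrite mulgV min_reps1 ?suppS.
move=> /splitPr us_u; case: us_u p => us1 us2; rewrite cat_path last_cat /=.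
case/and3P=> _ _ p; have := mem_last u us2; rewrite inE => /orP[/eqP->|].
  by apply/bhz_leP; rewrite mulgV min_reps1 ?suppS.
by move/(allP (order_path_min bhz_lt_trans p)) => /andP[].
Qed.

Lemma one_phi1 us : 1%g \in phi1 us.
Proof.
by apply/imsetP; exists (last 1%g us); rewrite ?mulgV //; apply: mem_last.
Qed.

Lemma card_phi1 us : path (bhz_lt S) 1%g us -> #|phi1 us| = (size us).+1.
Proof.
move=> p; rewrite card_imset => [|u v /mulgI/invg_inj//].
have /card_uniqP -> // : uniq (1%g :: us).
by apply: (sorted_uniq bhz_lt_trans bhz_lt_irr).
Qed.

(** Supports grow along the chain, so in reverse order they meet the hypothesis of [flag_cover]; the
    image consists of the corresponding minimal parts of the last element. *)
Lemma phi1_flag us : path (bhz_lt S) 1%g us ->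
  exists2 sigma, flag S 1%g sigma & phi1 us \subset sigma.
Proof.
move=> p; pose Js := rev [seq supp u | u <- 1%g :: us].
have [| | | | |sigma fl H] := @flag_cover S 1%g (last 1%g us) Js.
- exact: subxx.
- by apply: min_reps1.
- by rewrite genS inE.
- rewrite rev_sorted sorted_map.
  move: p; apply: (sub_path (e := bhz_lt S)) => u v.
  by case/andP=> _ /bhz_support.
- by apply/allP => A; rewrite mem_rev => /mapP[u _ ->]; apply: suppS.
exists sigma => //; apply/fintype.subsetP => _ /imsetP[u uus ->] /=.
rewrite (phi_min_part (bhz_path_last p uus)); apply: H.
by rewrite mem_rev map_f.
Qed.

(** The last element of each chain lies in the image of the other one, with lengths adding up;
    comparison both ways makes the last elements equal. The other elements are then recovered from
    the image. *)
Lemma phi1_inj us us' : path (bhz_lt S) 1%g us -> path (bhz_lt S) 1%g us' ->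
  phi1 us = phi1 us' -> us = us'.
Proof.
have lastE vs ws : path (bhz_lt S) 1%g vs -> path (bhz_lt S) 1%g ws ->
    phi1 vs = phi1 ws -> exists2 u, last 1%g vs = (last 1%g ws * u^-1)%g &
      len (last 1%g ws) = (len (last 1%g vs) + len u)%N.
  move=> p p' E; have: last 1%g vs \in phi1 ws.
    by rewrite -E; apply/imsetP; exists 1%g; rewrite ?mem_head // invg1 mulg1.
  case/imsetP=> u /(bhz_path_last p')/bhz_len le /= E'.
  by exists u; rewrite // le E'.
move=> p p' E; have [u uE lu] := lastE _ _ p p' E.
have [u' _ lu'] := lastE _ _ p' p (esym E).
have u1 : u = 1%g by apply: (len_eq0 genS); move: lu lu'; rewrite /len; lia.
have vE : last 1%g us = last 1%g us' by rewrite uE u1 invg1 mulg1.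
suff H : 1%g :: us =i 1%g :: us'.
  have := irr_sorted_eq bhz_lt_trans bhz_lt_irr (s1 := 1%g :: us) p.
  by move=> /(_ (1%g :: us') p' H) [].
have mem vs w : (w \in 1%g :: vs) = ((last 1%g vs * w^-1)%g \in phi1 vs).
  apply/idP/imsetP => [|[w' w'vs /mulgI/invg_inj->//]].
  by exists w.
by move=> w; rewrite !mem E vE.
Qed.

Lemma phi_cons1 us : phi (1%g :: us) = phi1 us.
Proof. by rewrite /phi inE eqxx. Qed.

Lemma phi_notin1 us : 1%g \notin us -> phi us = phi1 us :\ 1%g.
Proof. by rewrite /phi => /negPf->. Qed.

Lemma card_phi us : bhz_chain S us -> #|phi us| = size us.
Proof.
move=> /bhz_chain_cases[[us' -> p]|[_ p us1]].
  by rewrite phi_cons1 card_phi1.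
have := card_phi1 p; rewrite (cardsD1 1%g) one_phi1 add1n => -[].
by rewrite phi_notin1.
Qed.

Lemma one_phi us : bhz_chain S us -> (1%g \in phi us) = (1%g \in us).
Proof.
move=> /bhz_chain_cases[[us' -> p]|[_ p us1]].
  by rewrite phi_cons1 one_phi1 inE eqxx.
by rewrite phi_notin1 // !inE eqxx (negPf us1).
Qed.

Lemma phi_flag_face us : bhz_chain S us -> flag_face (phi us).
Proof.
move=> ch; split.
  by rewrite -card_gt0 card_phi // lt0n size_eq0; case: ch.
case/bhz_chain_cases: ch => [[us' -> p]|[_ p us1]].
  by rewrite phi_cons1; apply: phi1_flag.
have [sigma fl sub] := phi1_flag p; exists sigma; rewrite // phi_notin1 //.
exact: fintype.subset_trans (subD1set _ _) sub.
Qed.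

Lemma phi_inj us us' : bhz_chain S us -> bhz_chain S us' ->
  phi us = phi us' -> us = us'.
Proof.
move=> ch ch' E; have := one_phi ch'; rewrite -E (one_phi ch).
move: E; case/bhz_chain_cases: ch => [[vs -> p]|[_ p us1]];
  case/bhz_chain_cases: ch' => [[vs' -> p']|[_ p' us1']].
- by rewrite !phi_cons1 => /(phi1_inj p p')->.
- by rewrite inE eqxx (negPf us1').
- by rewrite inE eqxx (negPf us1).
rewrite !phi_notin1 // => E _; apply: phi1_inj => //.
by rewrite -(finset.setD1K (one_phi1 us)) -(finset.setD1K (one_phi1 us')) E.
Qed.

Lemma phi_surj F : flag_face F -> exists2 us, bhz_chain S us & phi us = F.
Proof.
case=> F0 [sigma fl Fs]; have S1 := min_reps1 (subxx S).
have [F1|F1] := boolP (1%g \in F).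
  have [us [y [p E _ _ /(_ F1)]]] := flag_chain fl (subxx S) S1 Fs F0.
  rewrite invg1 mul1g => lastE; exists (1%g :: us); first by split.
  by rewrite phi_cons1 E -lastE.
(* The identity is a vertex of [sigma] and may be adjoined to [F], which forces [y] to be the last
   element of the chain. *)
have [||us [y [p E _ _]]] := flag_chain fl (subxx S) S1 (G := 1%g |: F).
- by rewrite finset.subUset finset.sub1set (flag_min fl).
- by apply/set0Pn; exists 1%g; rewrite !inE eqxx.
rewrite !inE eqxx invg1 mul1g => /(_ isT) lastE.
have {}E : phi1 us = 1%g |: F by rewrite E -lastE.
have us1 := bhz_path1_notin p.
exists us; last by rewrite phi_notin1 // E finset.setU1K.
split; last exact: path_sorted p.
have := card_phi1 p; rewrite E cardsU1 F1 add1n => -[sz].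
by rewrite -size_eq0 -sz -lt0n card_gt0.
Qed.

(** * Faces of the permutahedron *)

Local Open Scope classical_set_scope.

Lemma orthogonal_fixed (J : {set gT}) c w : J \subset S ->
  {in J, forall s, dot (alpha s) c = 0} -> w \in <<J>>%g -> rho w *m c = c.
Proof.
move=> /fintype.subsetP JS c0 /gen_word[ws wsJ <-].
elim: ws wsJ => [|s ws IH] /=; first by rewrite big_nil rho1.
case/andP=> sJ /IH E; rewrite big_cons rhoM E rho_gen ?JS //.
by rewrite /mirror_coef c0 // mulr0 mul0r scale0r subr0.
Qed.

(** When [c] pairs nonnegatively with the roots of [I], this is the type of the face of
    [coset_poly 1 I] on which [c] is maximal. *)
Definition flat c I : {set gT} := [set s in I | dot (alpha s) c == 0]%SET.

Lemma flat_subset c I : flat c I \subset I.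
Proof. by apply/fintype.subsetP => s; rewrite inE => /andP[]. Qed.

Lemma flat_fix c I w : I \subset S -> w \in <<flat c I>>%g -> rho w *m c = c.
Proof.
move=> IS; apply: orthogonal_fixed.
  exact: fintype.subset_trans (flat_subset c I) IS.
by move=> s; rewrite inE => /andP[_ /eqP].
Qed.

(** Along a reduced word, each ascent from [w] to [w * s] lowers the value by a product of
    nonnegative factors, as [w] sends [alpha s] to a nonnegative combination of roots of [I]. *)
Lemma dominant_max c I v : I \subset S ->
  {in I, forall s, 0 <= dot (alpha s) c} -> v \in <<I>>%g ->
  dot c (rho v *m x) <= dot c x /\
  (dot c (rho v *m x) = dot c x -> v \in <<flat c I>>%g).
Proof.
move=> IS c0; move: v; apply: (reduced_ind IS) => [|w s wI sI p [le eq]].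
  by rewrite rho1 group1.
have sS := fintype.subsetP IS s sI; have k0 := mirror_coef_gt0 sS.
have [d [wE d0 dI]] := pos_cone_gen IS wI sI p.
have a0 : 0 <= dot c (rho w *m alpha s).
  rewrite dotC wE dot_comb sumr_ge0 // => t tS.
  have [tI|tI] := boolP (t \in I); last by rewrite dI // mul0r.
  by rewrite mulr_ge0 ?d0 ?c0.
rewrite rhoM (rho_gen _ sS) mulmxBr -scalemxAr dotBr dotZr.
have ka0 : 0 <= mirror_coef s x * dot c (rho w *m alpha s).
  by rewrite mulr_ge0 // ltW.
split=> [|E]; first lra.
have wJ : w \in <<flat c I>>%g by apply: eq; lra.
rewrite groupM // mem_gen // inE sI /=.
have: mirror_coef s x * dot c (rho w *m alpha s) = 0 by lra.
(* [w] fixes [c] by induction, so the vanishing factor is the pairing of [c] with [alpha s]. *)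
move/eqP; rewrite mulf_eq0 gt_eqF //= -{1}(flat_fix IS wJ).
by rewrite dot_rho dotC.
Qed.

Lemma dominant_flat c I v : I \subset S -> v \in <<flat c I>>%g ->
  dot c (rho v *m x) = dot c x.
Proof. by move=> IS vJ; rewrite -{1}(flat_fix IS vJ) dot_rho. Qed.

(** [x] is dominant and orthogonal to no simple root, so as a functional it is maximal on its orbit
    at [x] alone; isometry gives the other orbit points. *)
Lemma dot_x_max u v : dot (rho v *m x) (rho u *m x) <= dot x x /\
  (dot (rho v *m x) (rho u *m x) = dot x x -> u = v).
Proof.
have x0 : {in S, forall s, 0 <= dot (alpha s) x}.
  by move=> s sS; rewrite ltW // genx.
have uvS : (v^-1 * u)%g \in <<S>>%g by rewrite genS inE.
have [le eq] := dominant_max (subxx S) x0 uvS.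
rewrite dot_rhoV -rhoM; split=> // /eq.
have -> : flat x S = finset.set0.
  by apply/setP => s; rewrite !inE; case: (boolP (s \in S)) => //= sS;
    rewrite gt_eqF ?genx.
by rewrite gen0 => /set1gP/eqP; rewrite -eq_mulVg1 => /eqP.
Qed.

Lemma rho_x_inj u v : rho u *m x = rho v *m x -> u = v.
Proof.
by move=> E; have [_ eq] := dot_x_max u v; apply: eq; rewrite E dot_rho.
Qed.

(** * Hulls of cosets and their faces *)

Definition coset_pts w I : set 'cV[R]_n :=
  [set rho v *m x | v in [set v | (w^-1 * v)%g \in <<I>>%g]].

Definition coset_poly w I : set 'cV[R]_n := convex_hull (coset_pts w I).

Lemma coset_pts_self w I : coset_pts w I (rho w *m x).
Proof. by exists w; rewrite //= mulVg group1. Qed.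

Lemma coset_pts_eq w w' I : (w^-1 * w')%g \in <<I>>%g ->
  coset_pts w I = coset_pts w' I.
Proof.
move=> ww'; apply/seteqP; split=> _ [v /= vI <-]; exists v => //=.
  have -> : (w'^-1 * v = (w^-1 * w')^-1 * (w^-1 * v))%g.
    by rewrite invMg invgK mulgA mulgK.
  by rewrite groupM ?groupV.
have -> : (w^-1 * v = (w^-1 * w') * (w'^-1 * v))%g by rewrite mulgA mulgK.
by rewrite groupM.
Qed.

(** The functional given by [rho v *m x] is maximal on the orbit only at that point, so the hull of
    a coset without [v] lies strictly below that value. *)
Lemma coset_poly_vertex w I v : coset_poly w I (rho v *m x) ->
  (w^-1 * v)%g \in <<I>>%g.
Proof.
move=> hv; apply: contraT => vI.
have := @convex_hull_lt _ _ (coset_pts w I) (rho v *m x) (dot x x) _ _ hv.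
rewrite dot_rho ltxx; apply=> _ [u /= uI <-]; have [le eq] := dot_x_max u v.
rewrite lt_neqAle le andbT; apply: contra vI => /eqP/eq <-.
exact: uI.
Qed.

(** It suffices to look at the vertices [w'] and [w' * s] with [s] in [J]. *)
Lemma coset_poly_subset w I w' J : I \subset S -> J \subset S ->
  coset_poly w' J `<=` coset_poly w I ->
  (w^-1 * w')%g \in <<I>>%g /\ J \subset I.
Proof.
move=> IS JS sub; have ww' : (w^-1 * w')%g \in <<I>>%g.
  apply: coset_poly_vertex; apply: sub; apply: convex_hullS.
  exact: coset_pts_self.
split=> //; apply/fintype.subsetP => s sJ; have sS := fintype.subsetP JS s sJ.
apply: mem_gen_self => //; rewrite -(groupMl s ww') -mulgA.
apply: coset_poly_vertex; apply: sub; apply: convex_hullS.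
exists (w' * s)%g => //=.
by rewrite mulKg mem_gen.
Qed.

Lemma coset_polyS w I w' J : J \subset I -> (w^-1 * w')%g \in <<I>>%g ->
  coset_poly w' J `<=` coset_poly w I.
Proof.
move=> JI ww'; rewrite /coset_poly (coset_pts_eq ww').
apply: sub_smallest2r; first exact: convex_hull_convex.
move=> _ [v /= vJ <-]; exists v => //=.
exact: (fintype.subsetP (fingroup.genS JI)).
Qed.

Lemma coset_poly0 w : coset_poly w finset.set0 = [set rho w *m x].
Proof.
rewrite -convex_hull1 /coset_poly; congr convex_hull.
apply/seteqP; split=> [_ [v /= + <-]|_ ->]; last exact: coset_pts_self.
by rewrite gen0 => /set1gP/eqP; rewrite -eq_mulVg1 => /eqP->.
Qed.

Lemma coset_poly_neq0 w I : coset_poly w I <> set0.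
Proof.
move=> E; have : coset_poly w I (rho w *m x).
  by apply: convex_hullS; exact: coset_pts_self.
by rewrite E.
Qed.

(** Applying [w^-1] moves the problem to the coset of the identity, where [dominant_max] singles out
    the maximal vertices. *)
Lemma coset_exposed w I c : I \subset S ->
  {in I, forall s, 0 <= dot (alpha s) (rho w^-1%g *m c)} ->
  [set y | coset_poly w I y /\
     forall z, coset_poly w I z -> dot c z <= dot c y] =
  coset_poly w (flat (rho w^-1%g *m c) I).
Proof.
set c' := _ *m c => IS c0.
have dc v : dot c (rho v *m x) = dot c' (rho (w^-1 * v)%g *m x).
  by rewrite rhoM dot_rho.
rewrite (exposed_convex_hull (coset_pts_self w I) erefl); last first.
  move=> _ [v /= vI <-]; rewrite !dc mulVg rho1.
  by case: (dominant_max IS c0 vI).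
congr convex_hull; apply/seteqP; split.
  move=> _ [[v /= vI <-]]; rewrite !dc mulVg rho1 => E; exists v => //=.
  by case: (dominant_max IS c0 vI) => _; apply.
move=> _ [v /= vJ <-]; split; last first.
  by rewrite !dc mulVg rho1; apply: dominant_flat vJ.
exists v => //=.
exact: (fintype.subsetP (fingroup.genS (flat_subset c' I))).
Qed.

(** Seen from a vertex [w * v] where [c] is maximal, [c] is dominant for [I]: a negative pairing
    would make the neighbour [w * v * s] better. Then [coset_exposed] applies. *)
Lemma face_coset w I F : I \subset S -> face (coset_poly w I) F ->
  F = set0 \/ exists w' J,
    [/\ J \subset I, (w^-1 * w')%g \in <<I>>%g & F = coset_poly w' J].
Proof.
move=> IS [->|[c ->]]; [by left | right].
pose f v : R := dot c (rho (w * v)%g *m x).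
have [v vI vmax] : exists2 v, v \in <<I>>%g &
    forall u, u \in <<I>>%g -> f u <= f v.
  case: (@Order.TotalTheory.arg_maxP _ _ _ 1%g (mem <<I>>%g) f (group1 _)).
  by move=> v vI vmax; exists v.
have ww' : (w^-1 * (w * v))%g \in <<I>>%g by rewrite mulKg.
exists (w * v)%g, (flat (rho (w * v)^-1%g *m c) I); split=> //.
  exact: flat_subset.
rewrite -coset_exposed //.
  by rewrite /coset_poly (coset_pts_eq ww').
move=> s sI; have sS := fintype.subsetP IS s sI.
have := vmax (v * s)%g; rewrite groupM // ?mem_gen // => /(_ isT).
rewrite /f mulgA (rhoM (w * v)%g s) (rho_gen _ sS) mulmxBr.
rewrite -scalemxAr dotBr dotZr gerBl pmulr_rge0 ?mirror_coef_gt0 // => ge0.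
by rewrite -(dot_rho (w * v)%g) rhoVK dotC.
Qed.

Lemma coset_face w I w' J : I \subset S -> J \subset I ->
  (w^-1 * w')%g \in <<I>>%g -> face (coset_poly w I) (coset_poly w' J).
Proof.
move=> IS JI ww'; right.
have JS := fintype.subset_trans JI IS.
(* The sum of a W_J-orbit is orthogonal to the roots of J, and it stays in
   the open half-spaces of the other simple roots, which W_J keeps positive. *)
pose c' : 'cV[R]_n := \sum_(v in <<J>>%g) rho v *m x.
have inv s : s \in J -> rho s *m c' = c'.
  move=> sJ; rewrite /c' mulmx_sumr [RHS](reindex_inj (mulgI s)).
  apply: eq_big => [v|v _]; last by rewrite rhoM.
  by rewrite groupMl // mem_gen.
have c'J s : s \in J -> dot (alpha s) c' = 0.
  move=> sJ; have sS := fintype.subsetP JS s sJ.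
  have := dot_rho s (alpha s) c'.
  by rewrite inv // rho_gen_alpha // dotNl; lra.
have c'I s : s \in S -> s \notin J -> 0 < dot (alpha s) c'.
  move=> sS sJ; have p v : v \in <<J>>%g -> 0 < dot (alpha s) (rho v *m x).
    move=> vJ; rewrite dotC dot_rhoV dotC.
    apply: contraT => neg; case/negP: sJ.
    by apply: (neg_mem JS (w := v^-1%g)) => //; rewrite groupV.
  rewrite /c' dot_sumr (bigD1 1%g) //= ltr_pwDl ?p ?group1 //.
  by rewrite sumr_ge0 // => v /andP[vJ _]; rewrite ltW // p.
exists (rho w' *m c').
have flatE : flat c' I = J.
  apply/setP => s; rewrite inE; apply/andP/idP => [[sI]|sJ].
    by apply: contraTT => sJ; rewrite gt_eqF // c'I // (fintype.subsetP IS).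
  by rewrite c'J // eqxx (fintype.subsetP JI).
have := @coset_exposed w' I (rho w' *m c') IS; rewrite rhoK flatE => <-.
  by rewrite /coset_poly (coset_pts_eq ww').
move=> s sI; have [sJ|sJ] := boolP (s \in J); first by rewrite c'J.
by rewrite ltW // c'I // (fintype.subsetP IS).
Qed.

Lemma facet_point w F :
  facet (coset_poly w finset.set0) F <-> F = set0.
Proof.
have IS : finset.set0 \subset S by apply: finset.sub0set.
split=> [[/(face_coset IS)[//|[w' [J [J0 ww' ->]]]] ne _]|->].
  case: ne; move: J0; rewrite finset.subset0 => /eqP->.
  by rewrite /coset_poly (coset_pts_eq ww').
split; [by left | exact/nesym/coset_poly_neq0 |].
move=> G /(face_coset IS)[->|[w' [J [J0 ww' ->]]]] _; first by left.
right; move: J0; rewrite finset.subset0 => /eqP->.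
by rewrite /coset_poly (coset_pts_eq ww').
Qed.

(** A face of type [J] extends to one of type [I :\ s] for any [s] of [I] outside [J], and
    maximality makes the two equal. *)
Lemma facet_coset w I F : I \subset S -> I != finset.set0 ->
  facet (coset_poly w I) F -> exists w' s,
    [/\ s \in I, (w^-1 * w')%g \in <<I>>%g & F = coset_poly w' (I :\ s)].
Proof.
move=> IS /set0Pn[s0 s0I] [/(face_coset IS)[F0|[w' [J [JI ww' FE]]]] ne maxF].
  (* The empty face is not maximal: as [I] is nonempty, a vertex lies strictly between it and the
     polytope. *)
  have [| |GF|E] := maxF (coset_poly w finset.set0).
  - by apply: coset_face; rewrite ?finset.sub0set ?mulVg ?group1.
  - by rewrite F0.
  - by case: (@coset_poly_neq0 w finset.set0); rewrite GF.
  have [_ /fintype.subsetP/(_ s0 s0I)] : (w^-1 * w)%g \in <<finset.set0>>%g /\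
      I \subset finset.set0.
    by apply: coset_poly_subset; rewrite ?finset.sub0set ?E.
  by rewrite inE.
have [s sI sJ] : exists2 s, s \in I & s \notin J.
  apply/subsetPn/negP => IJ; case: ne; rewrite FE.
  have -> : J = I by apply/eqP; rewrite finset.eqEsubset JI.
  by rewrite /coset_poly (coset_pts_eq ww').
have KI : I :\ s \subset I by apply: subD1set.
have KS := fintype.subset_trans KI IS.
exists w', s; split=> //.
have [| | //|E] := maxF (coset_poly w' (I :\ s)).
- exact: coset_face.
- rewrite FE; apply: coset_polyS; rewrite ?mulVg ?group1 //.
  by rewrite finset.subsetD1 JI.
have [_ /fintype.subsetP/(_ s sI)] : (w'^-1 * w)%g \in <<I :\ s>>%g /\
    I \subset I :\ s.
  by apply: coset_poly_subset; rewrite // E.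
by rewrite !inE eqxx.
Qed.

Lemma coset_facet w I w' s : I \subset S -> s \in I ->
  (w^-1 * w')%g \in <<I>>%g ->
  facet (coset_poly w I) (coset_poly w' (I :\ s)).
Proof.
move=> IS sI ww'; have KI : I :\ s \subset I by apply: subD1set.
have KS := fintype.subset_trans KI IS.
split; first exact: coset_face.
  move=> E; have [_ /fintype.subsetP/(_ s sI)] :
      (w'^-1 * w)%g \in <<I :\ s>>%g /\ I \subset I :\ s.
    by apply: coset_poly_subset; rewrite // E.
  by rewrite !inE eqxx.
move=> G /(face_coset IS)[->|[w2 [K [K2I ww2 ->]]]].
  by rewrite subset0 => /coset_poly_neq0.
have K2S := fintype.subset_trans K2I IS.
move=> /(coset_poly_subset K2S KS)[w2w' KK2].
have [sK|sK] := boolP (s \in K).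
  right; have -> : K = I.
    apply/eqP; rewrite finset.eqEsubset K2I -(finset.setD1K sI).
    by rewrite finset.subUset finset.sub1set sK.
  by rewrite /coset_poly (coset_pts_eq ww2).
left; have <- : K = I :\ s.
  by apply/eqP; rewrite finset.eqEsubset KK2 finset.subsetD1 K2I sK.
by rewrite /coset_poly (coset_pts_eq w2w').
Qed.

Lemma vertex_coset w I y : I \subset S -> vertex (coset_poly w I) y <->
  exists2 u, (w^-1 * u)%g \in <<I>>%g & y = rho u *m x.
Proof.
move=> IS; split=> [/(face_coset IS)[/seteqP[/(_ y erefl)//]|]|[u wu ->]].
  move=> [u [J [JI wu E]]]; exists u => //.
  have: coset_poly u J (rho u *m x).
    by apply: convex_hullS; exact: coset_pts_self.
  by rewrite -E => ->.
by rewrite /vertex -coset_poly0; apply: coset_face; rewrite ?finset.sub0set.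
Qed.

(** Length additivity puts [c] below every vertex of its coset, so it is the only minimal one. *)
Lemma minimal_vertex_coset c I y : I \subset S -> c \in min_reps S I ->
  minimal_vertex (weak_le_pt S rho x) (coset_poly c I) y <-> y = rho c *m x.
Proof.
move=> IS cI.
have vc : vertex (coset_poly c I) (rho c *m x).
  by apply/vertex_coset => //; exists c; rewrite ?mulVg ?group1.
split=> [[/(vertex_coset _ _ IS)[u cu ->] ymin]|->].
  apply/esym/ymin => //; exists c, u; split=> //.
  have := min_reps_len IS cI cu; rewrite mulKVg /len => E.
  by rewrite /weak_le -E.
split=> // _ /(vertex_coset _ _ IS)[u cu ->] [a [b [ab]]].
move=> /rho_x_inj ua /rho_x_inj cb; subst a b; congr (rho _ *m x).
have := min_reps_len IS cI cu; rewrite mulKVg /len => E.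
have /(len_eq0 genS)/eqP : Defs.len S (c^-1 * u)%g = 0%N.
  by move: ab; rewrite /weak_le => /eqP; lia.
by rewrite -eq_mulVg1 => /eqP.
Qed.

(** * Pulling simplices as flags of cosets *)

Lemma pulling_simplex0 (le : 'cV[R]_n -> 'cV[R]_n -> Prop) tau :
  pulling_simplex le set0 tau -> tau = set0.
Proof.
move=> p; inversion p as [|Q F v sigma [[vx|[c vx]] _] _ _ _] => //.
  by have : [set v] v by []; rewrite vx.
by have : [set v] v by []; rewrite vx => -[].
Qed.

Definition orbit_set (sigma : {set gT}) : set 'cV[R]_n :=
  [set rho w *m x | w in [set` sigma]].

Lemma orbit_set_cone c sigma :
  orbit_set (c |: sigma) = (rho c *m x) |` orbit_set sigma.
Proof.
apply/seteqP; split=> [_ [w /= + <-]|_ [->|[w /= ws <-]]].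
- by rewrite !inE => /orP[/eqP->|ws]; [left | right; exists w].
- by exists c; rewrite //= !inE eqxx.
- by exists w; rewrite //= !inE ws orbT.
Qed.

Lemma orbit_set1 c : orbit_set [set c] = [set rho c *m x].
Proof.
apply/seteqP; split=> [_ [w /= + <-]|_ ->]; first by rewrite inE => /eqP->.
by exists c; rewrite //= inE.
Qed.

Lemma orbit_set_subset F sigma :
  orbit_set F `<=` orbit_set sigma <-> F \subset sigma.
Proof.
split=> [sub|/fintype.subsetP sub _ [w /= /sub ws <-]]; last by exists w.
apply/fintype.subsetP => w wF.
have [|u /= us /rho_x_inj<-//] := sub (rho w *m x).
by exists w.
Qed.

Local Notation pulling := (pulling_simplex (weak_le_pt S rho x)).

(** A facet avoiding [c] is the hull of a smaller coset, which is rewritten with its minimal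
    representative so that the induction hypothesis applies. *)
Lemma pulling_flag Q tau : pulling Q tau ->
  forall c I, I \subset S -> c \in min_reps S I -> Q = coset_poly c I ->
  exists2 sigma, flag I c sigma & tau = orbit_set sigma.
Proof.
elim=> [c I _ _ /esym/coset_poly_neq0//|{}Q F v tau' vmin facF Fv pF IH].
move=> c I IS cI QE; subst Q.
move: vmin => /(minimal_vertex_coset _ IS cI) vE; subst v.
have [I0|I0] := eqVneq I finset.set0.
  subst I; move: facF => /facet_point F0; subst F.
  rewrite (pulling_simplex0 pF); exists [set c]%SET; first exact: Flag_point.
  by rewrite orbit_set1 setU0.
have [w' [s [sI cw' FE]]] := facet_coset IS I0 facF.
have KI : I :\ s \subset I by apply: subD1set.
have KS := fintype.subset_trans KI IS.
have [c'K c'w'] := min_part_spec w' KS; set c' := min_part _ _ _ in c'K c'w'.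
have {}FE : F = coset_poly c' (I :\ s).
  by rewrite FE /coset_poly (coset_pts_eq c'w').
have [sigma fl ->] := IH c' _ KS c'K FE.
exists (c |: sigma); last by rewrite orbit_set_cone.
apply: (Flag_cone sI c'K _ _ fl).
  have -> : (c^-1 * c' = (c^-1 * w') * (c'^-1 * w')^-1)%g.
    by rewrite invMg invgK mulgA mulgK.
  by rewrite groupM ?groupV // (fintype.subsetP (fingroup.genS KI)).
apply/negP => c'c; apply: Fv; rewrite FE; apply: convex_hullS.
by exists c.
Qed.

Lemma flag_pulling I c sigma : flag I c sigma -> I \subset S ->
  c \in min_reps S I -> pulling (coset_poly c I) (orbit_set sigma).
Proof.
elim=> [{}c|{}I s {}c c' {}sigma sI c'K cc' c'c _ IH] IS cI.
  rewrite orbit_set1 -[X in pulling _ X]setU0; apply: Pulling_cone.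
  - exact/minimal_vertex_coset.
  - exact/facet_point.
  - by [].
  - exact: Pulling_empty.
have KI : I :\ s \subset I by apply: subD1set.
have KS := fintype.subset_trans KI IS.
rewrite orbit_set_cone; apply: (Pulling_cone (F := coset_poly c' (I :\ s))).
- exact/minimal_vertex_coset.
- exact: coset_facet.
- by move/coset_poly_vertex; apply/negP.
- exact: IH.
Qed.

Lemma perm_polytopeE : perm_polytope rho x = coset_poly 1%g S.
Proof.
congr convex_hull; apply/seteqP; split=> _ [w _ <-]; exists w => //=.
by rewrite genS inE.
Qed.

Lemma delta_face_flag F : delta_face S rho x F <-> flag_face F.
Proof.
have S1 := min_reps1 (subxx S); rewrite /delta_face /pulling_face.
rewrite perm_polytopeE -/(orbit_set F); split.
  case=> -[_ [w /= wF _]] [tau p sub]; split; first by apply/set0Pn; exists w.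
  have [sigma fl E] := pulling_flag p (subxx S) S1 erefl.
  by exists sigma => //; apply/orbit_set_subset; rewrite -E.
case=> /set0Pn[w wF] [sigma fl sub]; split.
  by exists (rho w *m x), w.
exists (orbit_set sigma); last exact/orbit_set_subset.
exact: flag_pulling.
Qed.

End Roots.

Theorem theorem6p1 (R : realType) (gT : finGroupType) (S : {set gT}) (n : nat)
    (rho : mx_representation R [set: gT]%G n)
    (alpha : gT -> 'cV[R]_n) (x : 'cV[R]_n)
    (coxS : coxeter_system S)
    (reflS : reflection_action S rho alpha)
    (genx : in_chamber S alpha x) :
  set_bij [set us : seq gT | bhz_chain S us]%classic
          [set F : {set gT} | delta_face S rho x F]%classic
          (@phi gT) /\
  (forall k : nat, (0 < k)%N ->
     set_bij [set us : seq gT | bhz_chain S us /\ size us = k]%classic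
             [set F : {set gT} | delta_face S rho x F /\ #|F| = k]%classic
             (@phi gT)).
Proof.
case: coxS => genS ordS _.
have face us : bhz_chain S us -> delta_face S rho x (phi us).
  move=> ch; apply/(delta_face_flag genS ordS reflS genx).
  exact: phi_flag_face reflS genx us ch.
have card us := card_phi genS ordS reflS genx (us := us).
have inj us us' := phi_inj genS ordS reflS genx (us := us) (us' := us').
have surj F : delta_face S rho x F -> exists2 us, bhz_chain S us & phi us = F.
  move/(delta_face_flag genS ordS reflS genx).
  exact: (phi_surj genS ordS reflS genx).
split=> [|k _]; split.
- exact: face.
- by move=> us us' /set_mem ch /set_mem ch'; apply: inj.
- by move=> F /surj[us ch <-]; exists us.
- by move=> us [ch <-]; split; [exact: face | exact: card].
- by move=> us us' /set_mem[ch _] /set_mem[ch' _]; apply: inj.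
- move=> F [/surj[us ch <-]]; rewrite card // => sz.
  by exists us.
Qed.
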